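(* Let $G$ be a graph with $n$ vertices and minimum degree $\delta$, and let $k$ be a positive integer. (i) If $span(G) \geq R(k,k)$ and $\delta \geq k$, then $\gamma_{ir}(G) \leq n-k$. (ii) If $span(G) \geq 5$ and $\delta \geq 3$, then $\gamma_{ir}(G) \leq n-3$.
   Context: All graphs are finite, simple, undirected and have at least one vertex. $N(v)$ denotes the set of neighbours of a vertex $v$. A dominating set of $G$ is a set $D \subseteq V(G)$ such that every vertex in $V(G)\setminus D$ has a neighbour in $D$. An irregular dominating set of $G$ is a dominating set $D$ of $G$ such that $|N(u) \cap D| \neq |N(v) \cap D|$ for every two distinct vertices $u, v \in V(G) \setminus D$ (in particular, $V(G)$ is one). The irregular domination number $\gamma_{ir}(G)$ is the size of a smallest irregular dominating set of $G$. $span(G)$ is the number of distinct vertex degrees of $G$. The Ramsey number $R(p,q)$ is the smallest number $N$ such that every graph on $N$ vertices contains a clique of order $p$ or an independent set of order $q$. *)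

(* Defs.v *)
From HB Require Import structures.
From mathcomp Require Import all_boot.
From mathcomp Require Import boolp.

Set Implicit Arguments.
Unset Strict Implicit.
Unset Printing Implicit Defensive.

(* Nonemptiness of the vertex set is not part of the structure: the theorem
   assumes it separately. *)
Record sgraph := SGraph {
  vertex :> finType;
  adj : rel vertex;
  adj_sym : symmetric adj;
  adj_irr : irreflexive adj }.

Section Graph.
Variable G : sgraph.
Implicit Types (u v : G) (D K : {set G}).

Definition nbh v : {set G} := [set u | adj v u].

Definition degree v : nat := #|nbh v|.

(* Every degree is smaller than #|G|, so the default value is never reached
   when G has a vertex. *)
Definition min_degree : nat := \big[minn/#|G|]_(v : G) degree v.

Definition span : nat := size (undup [seq degree v | v : G]).

Definition clique K : bool :=
  [forall u in K, forall v in K, (u != v) ==> adj u v].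

Definition independent K : bool :=
  [forall u in K, forall v in K, ~~ adj u v].

Definition dominating D : bool :=
  [forall v in ~: D, exists u in D, adj v u].

Definition irregular_dominating D : bool :=
  dominating D &&
  [forall u in ~: D, forall v in ~: D,
     (u != v) ==> (#|nbh u :&: D| != #|nbh v :&: D|)].

(* Shows that the minimum in gamma_ir is over a nonempty family. *)
Lemma irregular_dominatingT : irregular_dominating [set: G].
Proof.
by apply/andP; split; apply/forall_inP => v; rewrite setCT inE.
Qed.

Definition gamma_ir : nat :=
  #|[arg min_(D < [set: G] | irregular_dominating D) #|D|]|.

End Graph.

(* The graph with no vertex is allowed here, so that N = 0 does not satisfy
   the property vacuously when p and q are positive. *)
Definition ramsey_property (p q N : nat) : Prop :=
  forall G : sgraph, #|G| = N ->
    (exists2 K : {set G}, clique K & #|K| = p) \/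
    (exists2 K : {set G}, independent K & #|K| = q).

Lemma ramsey_subset (p q : nat) : exists N, forall (G : sgraph) (A : {set G}),
  N <= #|A| ->
    (exists K : {set G}, [/\ K \subset A, clique K & #|K| = p]) \/
    (exists K : {set G}, [/\ K \subset A, independent K & #|K| = q]).
Proof.
have [m le_m] := ubnP (p + q); elim: m p q le_m => // m IH [|p] [|q] le_m.
1-3: exists 0 => G A _.
- by left; exists set0; split; rewrite ?sub0set ?cards0 //;
    apply/forall_inP => u; rewrite inE.
- by left; exists set0; split; rewrite ?sub0set ?cards0 //;
    apply/forall_inP => u; rewrite inE.
- by right; exists set0; split; rewrite ?sub0set ?cards0 //;
    apply/forall_inP => u; rewrite inE.
have [|N1 H1] := IH p q.+1; first by rewrite -ltnS.
have [|N2 H2] := IH p.+1 q; first by rewrite -ltnS -addnS.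
exists (N1 + N2).+1 => G A le_A.
have /card_gt0P[x xA] : 0 < #|A| by apply: leq_trans le_A.
pose B := (A :\ x) :&: nbh x; pose C := (A :\ x) :\: nbh x.
have cardBC : N1 + N2 <= #|B| + #|C|.
  by rewrite cardsID; move: le_A; rewrite (cardsD1 x) xA.
have sBA : B \subset A by rewrite (subset_trans (subsetIl _ _)) ?subsetDl.
have sCA : C \subset A by rewrite (subset_trans (subsetDl _ _)) ?subsetDl.
have [le_B|lt_B] := leqP N1 #|B|.
  have [[K [sKB cK oK]]|[K [sKB iK oK]]] := H1 G B le_B; last first.
    by right; exists K; split=> //; apply: subset_trans sBA.
  left; exists (x |: K); split.
  - by rewrite subUset sub1set xA (subset_trans sKB).
  - apply/forall_inP => u /setU1P[->|uK]; apply/forall_inP => v /setU1P[->|vK].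
    + by rewrite eqxx.
    + by have /setIP[_] := subsetP sKB v vK; rewrite inE => ->; rewrite implybT.
    + have /setIP[_] := subsetP sKB u uK.
      by rewrite inE adj_sym => ->; rewrite implybT.
    + by move/forall_inP: cK => /(_ u uK)/forall_inP/(_ v vK).
  - rewrite cardsU1 oK; case: (boolP (x \in K)) => // /(subsetP sKB).
    by rewrite !inE eqxx.
have le_C : N2 <= #|C|.
  by rewrite -(leq_add2l N1) (leq_trans cardBC) // leq_add2r ltnW.
have [[K [sKC cK oK]]|[K [sKC iK oK]]] := H2 G C le_C.
  by left; exists K; split=> //; apply: subset_trans sCA.
right; exists (x |: K); split.
- by rewrite subUset sub1set xA (subset_trans sKC).
- apply/forall_inP => u /setU1P[->|uK]; apply/forall_inP => v /setU1P[->|vK].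
  + by rewrite adj_irr.
  + by have /setDP[_] := subsetP sKC v vK; rewrite inE.
  + by have /setDP[_] := subsetP sKC u uK; rewrite inE adj_sym.
  + by move/forall_inP: iK => /(_ u uK)/forall_inP/(_ v vK).
- rewrite cardsU1 oK; case: (boolP (x \in K)) => // /(subsetP sKC).
  by rewrite !inE eqxx andbF.
Qed.

Lemma ramsey_exists (p q : nat) : exists N, `[< ramsey_property p q N >].
Proof.
have [N HN] := ramsey_subset p q; exists N; apply/asboolP => G oG.
have := HN G [set: G]; rewrite cardsT oG => /(_ (leqnn N)).
by case=> -[K [_ ? ?]]; [left | right]; exists K.
Qed.

Definition ramsey_number (p q : nat) : nat := ex_minn (ramsey_exists p q).

(* Main.v *)
Require Import Defs.
From mathcomp Require Import all_boot.
From mathcomp Require Import boolp zify.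

Set Implicit Arguments.
Unset Strict Implicit.
Unset Printing Implicit Defensive.

(* If S has at most delta vertices, its complement D is dominating, and
   |N(v) :&: D| = deg v - |N(v) :&: S| for v in S.  Choose a set A of span(G)
   vertices with distinct degrees.  A clique or an independent set S in A makes
   |N(v) :&: S| constant on S, which gives (i).  For (ii), let x have the least
   degree in A.  If x has two neighbours a, b in A, then S = {x, a, b} works:
   it is a triangle or a path with middle x, where x, already of least degree,
   loses the most.  Otherwise x has three non-neighbours in A; either two of
   them are non-adjacent and form with x an independent set, or they form a
   triangle. *)

Lemma min_degree_le (G : sgraph) (v : G) : min_degree G <= degree v.
Proof.
rewrite /min_degree; elim: (index_enum G) (mem_index_enum v) => // u s IH.
by rewrite inE big_cons geq_min => /orP[/eqP->|/IH->]; rewrite ?leqnn ?orbT.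
Qed.

Lemma exists_degree_transversal (G : sgraph) :
  exists A : {set G}, {in A &, injective (@degree G)} /\ span G <= #|A|.
Proof.
(* The search succeeds at [v] itself at the latest, so the default is never returned and [rep v]
   depends only on the degree of [v]. *)
pose rep (v : G) := odflt v [pick u | degree u == degree v].
have degree_rep v : degree (rep v) = degree v.
  by rewrite /rep; case: pickP => [u /eqP|].
have rep_eq u v : degree u = degree v -> rep u = rep v.
  by rewrite /rep => ->; case: pickP => // /(_ v); rewrite eqxx.
exists [set rep v | v : G]; split.
  move=> _ _ /imsetP[u _ ->] /imsetP[v _ ->].
  by rewrite !degree_rep => /rep_eq.
rewrite cardE -(size_map (@degree G)).
apply: uniq_leq_size (undup_uniq _) _ => d.
rewrite mem_undup => /mapP[v _ ->]; rewrite -degree_rep map_f //.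
by rewrite mem_enum imset_f.
Qed.

Lemma gamma_ir_le (G : sgraph) (S : {set G}) :
    #|S| <= min_degree G ->
    {in S &, injective (fun v : G => #|nbh v :\: S|)} ->
  gamma_ir G <= #|G| - #|S|.
Proof.
move=> leS injS; rewrite -[S in leqRHS]setCK -cardsCs /gamma_ir.
case: arg_minnP => [|D _ minD]; first exact: irregular_dominatingT.
apply: minD; apply/andP; split.
  apply/forall_inP => v; rewrite setCK => vS.
  have /card_gt0P[u] : 0 < #|nbh v :\: S|.
    (* The inequality is strict because [v] lies in [S] but not in [nbh v]; as [degree v] is at
       least #|S|, a neighbour outside [S] remains. *)
    have lt : #|nbh v :&: S| < #|S|.
      apply: proper_card; apply/properP; split; first exact: subsetIr.
      by exists v; rewrite // !inE adj_irr.
    have := min_degree_le v; have := cardsID S (nbh v); rewrite /degree; lia.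
  by rewrite !inE => /andP[uS uv]; apply/exists_inP; exists u; rewrite ?inE.
apply/forall_inP => u; rewrite setCK => uS.
apply/forall_inP => v vS; apply/implyP; apply: contraNN => /eqP.
by rewrite -!setDE => /injS ->.
Qed.

(** Every vertex of [S] loses the same number [c] of neighbours, so distinct degrees stay
    distinct. *)
Lemma gamma_ir_le_regular (G : sgraph) (S : {set G}) (c : nat) :
    #|S| <= min_degree G -> {in S &, injective (@degree G)} ->
    {in S, forall v : G, #|nbh v :&: S| = c} ->
  gamma_ir G <= #|G| - #|S|.
Proof.
move=> leS injS regS; apply: gamma_ir_le => // u v uS vS /= eq_uv.
by apply: injS; rewrite // /degree -(cardsID S) eq_uv regS // -(regS v) // cardsID.
Qed.

Lemma clique_nbh (G : sgraph) (K : {set G}) (v : G) :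
  clique K -> v \in K -> nbh v :&: K = K :\ v.
Proof.
move=> /forall_inP cK vK; apply/setP => u; rewrite !inE.
case uK: (u \in K); rewrite ?andbF // !andbT.
have /forall_inP/(_ u uK) := cK v vK; case: eqVneq => [->|_ /= ->] //.
by rewrite adj_irr.
Qed.

Lemma independent_nbh (G : sgraph) (K : {set G}) (v : G) :
  independent K -> v \in K -> nbh v :&: K = set0.
Proof.
move=> /forall_inP iK vK; apply/setP => u; rewrite !inE.
case uK: (u \in K); rewrite ?andbF // andbT.
by have /forall_inP/(_ u uK)/negbTE := iK v vK.
Qed.

Section Induced.
Variables (G : sgraph) (B : {set G}).

Definition induced_adj : rel {x : G | x \in B} := relpre val (@adj G).

Lemma induced_adj_sym : symmetric induced_adj.
Proof. by move=> u v; apply: adj_sym. Qed.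

Lemma induced_adj_irr : irreflexive induced_adj.
Proof. by move=> u; apply: adj_irr. Qed.

(** Turns a vertex set into a graph of its own, to which [ramsey_property] applies. *)
Definition induced : sgraph := SGraph induced_adj_sym induced_adj_irr.

Lemma card_induced : #|induced| = #|B|.
Proof. exact: card_sig. Qed.

Lemma induced_sub (K : {set induced}) : val @: K \subset B.
Proof. by apply/subsetP => _ /imsetP[u _ ->]; apply: valP. Qed.

Lemma clique_induced (K : {set induced}) : clique K -> clique (val @: K).
Proof.
move=> /forall_inP cK; apply/forall_inP => _ /imsetP[u uK ->].
apply/forall_inP => _ /imsetP[v vK ->].
by have /forall_inP/(_ v vK) := cK u uK.
Qed.

Lemma independent_induced (K : {set induced}) :
  independent K -> independent (val @: K).
Proof.
move=> /forall_inP iK; apply/forall_inP => _ /imsetP[u uK ->].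
apply/forall_inP => _ /imsetP[v vK ->].
by have /forall_inP/(_ v vK) := iK u uK.
Qed.

End Induced.

Lemma ramsey_numberP (p q : nat) : ramsey_property p q (ramsey_number p q).
Proof. by rewrite /ramsey_number; case: ex_minnP => N /asboolP. Qed.

Lemma ramsey_number_subset (p q : nat) (G : sgraph) (A : {set G}) :
    ramsey_number p q <= #|A| ->
  (exists K : {set G}, [/\ K \subset A, clique K & #|K| = p]) \/
  (exists K : {set G}, [/\ K \subset A, independent K & #|K| = q]).
Proof.
(* [ramsey_property] concerns graphs of one exact order, so [A] is first cut down to that many
   vertices. *)
move=> /card_geqP[s [uniq_s size_s sA]].
pose B : {set G} := [set x in s].
have sBA : B \subset A by apply/subsetP => x; rewrite inE => /sA.
have cardB : #|induced B| = ramsey_number p q.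
  by rewrite card_induced cardsE (card_uniqP uniq_s).
have [[K hK <-]|[K hK <-]] := ramsey_numberP cardB; [left | right];
  exists (val @: K); split;
  rewrite ?card_imset ?(subset_trans (induced_sub K)) //; try exact: val_inj.
- exact: clique_induced.
- exact: independent_induced.
Qed.

Lemma card_nbh_triple (G : sgraph) (a b c v : G) :
    a != b -> a != c -> b != c ->
  #|nbh v :&: [set a; b; c]| = adj v a + adj v b + adj v c.
Proof.
move=> ab ac bc; rewrite setIC.
have -> : [set a; b; c] :&: nbh v = [set x in a |: (b |: [set c]) | adj v x].
  by apply/setP => x; rewrite !inE orbA.
rewrite -sum1dep_card big_mkcondr /= !big_setU1 ?big_set1 ?inE ?negb_or ?ab //=.
by do 3!case: (adj _ _).
Qed.

(** The three inequations compare degree minus neighbours inside the triple, with the subtracted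
    terms moved across to avoid truncated subtraction. *)
Lemma gamma_ir_le_triple (G : sgraph) (a b c : G) :
    3 <= min_degree G -> a != b -> a != c -> b != c ->
    degree a + adj b a + adj b c != degree b + adj a b + adj a c ->
    degree a + adj c a + adj c b != degree c + adj a b + adj a c ->
    degree b + adj c a + adj c b != degree c + adj b a + adj b c ->
  gamma_ir G <= #|G| - 3.
Proof.
move=> deg3 ab ac bc dab dac dbc.
have cardS : #|[set a; b; c]| = 3.
  by rewrite setUC cardsU1 cards2 !inE negb_or ab ![c == _]eq_sym ac bc.
rewrite -cardS; apply: gamma_ir_le; rewrite ?cardS // => u v uS vS /= eq_uv.
have := cardsID [set a; b; c] (nbh u); have := cardsID [set a; b; c] (nbh v).
rewrite -!/(degree _) eq_uv !card_nbh_triple //.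
move: uS vS; rewrite !inE => /orP[/orP[]|] /eqP -> /orP[/orP[]|] /eqP -> //;
  rewrite !adj_irr; lia.
Qed.

Lemma gamma_ir_le_sub3 (G : sgraph) :
  5 <= span G -> 3 <= min_degree G -> gamma_ir G <= #|G| - 3.
Proof.
move=> span5 deg3; have [A [injA leA]] := exists_degree_transversal G.
have card5 : 5 <= #|A| by apply: leq_trans leA.
have neqA u v : u \in A -> v \in A -> u != v -> degree u != degree v.
  by move=> uA vA; apply: contraNN => /eqP/injA ->.
have /card_gt0P[x0 x0A] : 0 < #|A| by apply: leq_trans card5.
case: (arg_minnP (@degree G) x0A) => x Ax minx.
have xA : x \in A := Ax.
have := cardsID (nbh x) (A :\ x).
have cardAx : 4 <= #|A :\ x| by move: card5; rewrite (cardsD1 x) xA.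
have [/card_gt1P[a [b []]] | lt2 cardN] := ltnP 1 #|(A :\ x) :&: nbh x|.
  rewrite !inE => /andP[/andP[ax aA] xa] /andP[/andP[bx bA] xb] ab _.
  move: (minx a aA) (minx b bA) => lexa lexb.
  have := neqA _ _ aA xA ax; have := neqA _ _ bA xA bx.
  have := neqA _ _ aA bA ab => dab dbx dax.
  (* Here [x] loses 2, while [a] and [b] each lose 1 + [adj a b], which is at most 2. *)
  apply: (@gamma_ir_le_triple G x a b) => //; rewrite 1?eq_sym //;
    rewrite ?(adj_sym b a) ?(adj_sym a x) ?(adj_sym b x) ?xa ?xb; lia.
(* At most one of the at least four vertices of [A :\ x] is adjacent to [x]. *)
have /card_gt2P[a [b [c []]]] : 2 < #|(A :\ x) :\: nbh x| by lia.
rewrite !inE => -[/and3P[nxa ax aA] /and3P[nxb bx bA] /and3P[nxc cx cA]] [ab bc ca].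
have indep u v : u \in A -> v \in A -> u != x -> v != x -> u != v ->
    ~~ adj x u -> ~~ adj x v -> ~~ adj u v -> gamma_ir G <= #|G| - 3.
  move=> uA vA ux vx uv /negbTE nxu /negbTE nxv /negbTE nuv.
  apply: (@gamma_ir_le_triple G x u v) => //; rewrite 1?[x == _]eq_sym //;
    rewrite ?(adj_sym v u) ?(adj_sym u x) ?(adj_sym v x) ?nxu ?nxv ?nuv ?addn0;
    by apply: neqA; rewrite // eq_sym.
have [eab|] := boolP (adj a b); last exact: indep.
have [ebc|] := boolP (adj b c); last exact: indep.
have [eca|] := boolP (adj c a); last exact: indep.
(* In the triangle each vertex loses 2. *)
apply: (@gamma_ir_le_triple G a b c) => //; rewrite 1?[a == c]eq_sym //;
  rewrite ?(adj_sym b a) ?(adj_sym c b) ?(adj_sym a c) ?eab ?ebc ?eca ?eqn_add2r;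
  by apply: neqA; rewrite // eq_sym.
Qed.

Theorem theorem4p5 (G : sgraph) (n delta k : nat)
    (G_nonempty : 0 < #|G|) (card_G : #|G| = n)
    (min_degree_G : min_degree G = delta) (k_gt0 : 0 < k) :
  (ramsey_number k k <= span G -> k <= delta -> gamma_ir G <= n - k) /\
  (5 <= span G -> 3 <= delta -> gamma_ir G <= n - 3).
Proof.
rewrite -card_G -min_degree_G; split; last exact: gamma_ir_le_sub3.
move=> le_span le_k; have [A [injA leA]] := exists_degree_transversal G.
have [[K [sKA cK oK]]|[K [sKA iK oK]]] :=
  ramsey_number_subset (leq_trans le_span leA);
  rewrite -oK; have injK := sub_in2 (subsetP sKA) injA.
(* A vertex of a clique of order [k] is adjacent to the [k.-1] others. *)
- apply: (@gamma_ir_le_regular G K k.-1) => //; first by rewrite oK.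
  by move=> v vK; rewrite clique_nbh // -oK (cardsD1 v K) vK.
- apply: (@gamma_ir_le_regular G K 0) => //; first by rewrite oK.
  by move=> v vK; rewrite independent_nbh // cards0.
Qed.
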